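(* (a) For the KRW system and any $\epsilon\in(0,\infty)$, $\mathbb{P}$-a.s. any fixed point $\widehat{\boldsymbol\theta^\epsilon}$ belongs to the deterministic set $$\mathcal{S}_1:=\big\{\boldsymbol\theta\in\mathbb{T}^N:\ b_i(\boldsymbol\theta,\mathbf x)=0\ \ \forall\,\mathbf x\in V^N,\ i=1,\dots,N\big\}.$$ For the DRC system and any $\epsilon,\kappa\in(0,\infty)$, $\mathbb{P}$-a.s. any fixed point $\widehat{\boldsymbol\theta^{\epsilon,\kappa}}$ belongs to the deterministic set $$\mathcal{S}_2:=\big\{\boldsymbol\theta\in\mathbb{T}^{|V|}:\ b_u(\boldsymbol\theta,\mathcal{E})=0\ \ \forall\,\mathcal{E}\subset E,\ u\in V\big\}.$$ (b) Now let $\boldsymbol\omega=\mathbf 0$. For KRW, assume that the skeleton graph $\mathbb{G}$ is not complete, i.e. there exists a pair of vertices $u^*\ne v^*$ in $V$ with $\pi(u^*,v^* )=0$. Then $$\mathcal{S}_1=\big\{\boldsymbol\theta\in\mathbb{T}^N:\ |\theta_i-\theta_j|\in\{0,\pi\}\ \ \forall\, i,j=1,\dots,N\big\}.$$ For DRC, $$\mathcal{S}_2=\big\{\boldsymbol\theta\in\mathbb{T}^{|V|}:\ |\theta_u-\theta_v|\in\{0,\pi\}\ \ \forall\, u,v\in V\big\}.$$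
   Context: Skeleton. $\mathbb{G}=(V,E)$ is a finite connected graph with symmetric weights $\pi(u,v)=\pi(v,u)\in[0,\infty)$ for $u,v\in V$; the edges are the (unordered) pairs $\{u,v\}$ (possibly $u=v$) with $\pi(u,v)>0$. Put $\pi(u)=\sum_{v\in V}\pi(u,v)>0$. $K>0$ is a constant, $N\ge2$ an integer. $\mathbb{T}^n=(\mathbb{R}/2\pi\mathbb{Z})^n$. For $\theta_i,\theta_j\in\mathbb{T}$, $|\theta_i-\theta_j|\in[0,\pi]$ denotes geodesic distance on the circle. Kuramoto Random Walk (KRW). Assume in addition that every vertex has a self-loop: $\pi(u,u)>0$ for all $u\in V$. For $\epsilon\in(0,\infty)$, $\mathbf X^\epsilon(t)=(X^\epsilon_1(t),\dots,X^\epsilon_N(t))$ consists of $N$ independent continuous-time random walks on $\mathbb{G}$: each walk jumps at constant rate $\epsilon^{-1}$, and from $u$ it jumps to $v$ with probability $\pi(u,v)/\pi(u)$. The starting point $\mathbf X^\epsilon(0)=\mathbf x^\epsilon_0\in V^N$ is given. For $\mathbf x\in V^N$ let $a_{ij}(\mathbf x)=\pi(x_i,x_j)$ and, with natural frequencies $\boldsymbol\omega=(\omega_i)_{i=1}^N\in\mathbb{R}^N$, $$b_i(\boldsymbol\theta,\mathbf x)=\omega_i+\frac{K}{N}\sum_{j=1}^N a_{ij}(\mathbf x)\sin(\theta_j-\theta_i),\quad \boldsymbol\theta\in\mathbb{T}^N,\ i=1,\dots,N.$$ The KRW system is $\frac{d}{dt}\theta_i^\epsilon(t)=b_i(\boldsymbol\theta^\epsilon(t),\mathbf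 X^\epsilon(t))$, $i=1,\dots,N$, $t\ge 0$. Kuramoto model on the Dynamic Random Conductance Model (DRC). For $\epsilon,\kappa>0$, each edge $e\in E$ carries an independent continuous-time Markov chain $(e^{\epsilon,\kappa}(t))_{t\ge0}$ on $\{0,1\}$, which jumps from $1$ to $0$ at rate $\epsilon^{-1}$ and from $0$ to $1$ at rate $\kappa$, started at $e^{\epsilon,\kappa}(0)=1$. Let $\mathcal{E}^{\epsilon,\kappa}(t)=\{e\in E:e^{\epsilon,\kappa}(t)=1\}$. For $\mathcal{E}\subset E$ let $a_{uv}(\mathcal{E})=1_{\{\{u,v\}\in\mathcal{E}\}}\pi(u,v)$ and, with natural frequencies $\boldsymbol\omega=(\omega_u)_{u\in V}\in\mathbb{R}^{|V|}$, $$b_u(\boldsymbol\theta,\mathcal{E})=\omega_u+\frac{K}{|V|}\sum_{v\in V}a_{uv}(\mathcal{E})\sin(\theta_v-\theta_u),\quad \boldsymbol\theta\in\mathbb{T}^{|V|},\ u\in V.$$ The DRC system is $\frac{d}{dt}\theta_u^{\epsilon,\kappa}(t)=b_u(\boldsymbol\theta^{\epsilon,\kappa}(t),\mathcal{E}^{\epsilon,\kappa}(t))$, $u\in V$, $t>0$. Fixed points. For KRW, $\widehat{\boldsymbol\theta^\epsilon}\in\mathbb{T}^N$ is a fixed point (equilibrium) if $\mathbb{P}$-a.s. $b_i(\widehat{\boldsymbol\theta^\epsilon},\mathbf X^\epsilon(t))=0$ for all $t\ge0$ and $i=1,\dots,N$. For DRC, $\widehat{\boldsymbol\theta^{\epsilon,\kappa}}\in\mathbb{T}^{|V|}$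 is a fixed point if $\mathbb{P}$-a.s. $b_u(\widehat{\boldsymbol\theta^{\epsilon,\kappa}},\mathcal{E}^{\epsilon,\kappa}(t))=0$ for all $t\ge0$ and $u\in V$. *)

(* Defs.v *)
From HB Require Import structures.
From mathcomp Require Import all_boot all_order all_algebra.
From mathcomp Require Import all_classical all_reals all_analysis.
Import Order.TTheory GRing.Theory Num.Theory.
Import numFieldNormedType.Exports.

Set Implicit Arguments.
Unset Strict Implicit.
Unset Printing Implicit Defensive.

Local Open Scope classical_set_scope.
Local Open Scope ring_scope.
Local Open Scope quotient_scope.

(* In names, "krw" is the Kuramoto random walk and "drc" the Kuramoto model on
   the dynamic random conductance model. *)

Definition two_pi_multiple (R : realType) : {pred R} :=
  fun x => x / (2 * pi) \is a Num.int.

Lemma two_pi_multiple_zmod_closed (R : realType) :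
  zmod_closed (@two_pi_multiple R).
Proof.
split; first by rewrite unfold_in mul0r rpred0.
by move=> x y; rewrite !unfold_in mulrBl => hx hy; exact: rpredB.
Qed.

HB.instance Definition _ (R : realType) :=
  GRing.isZmodClosed.Build R (@two_pi_multiple R)
    (@two_pi_multiple_zmod_closed R).

(* The torus of dimension I is represented by [I -> circle R]. *)
Definition circle (R : realType) : zmodType :=
  Quotient.quot (@two_pi_multiple R : zmodClosed R).

Definition angle (R : realType) (x : R) : circle R :=
  \pi_(Quotient.quot (@two_pi_multiple R : zmodClosed R)) x.

Definition circle_sin (R : realType) (a : circle R) : R :=
  sin (repr (a : Quotient.quot (@two_pi_multiple R : zmodClosed R))).

Lemma circle_sin_angle (R : realType) (x : R) : circle_sin (angle x) = sin x.
Proof.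
have sinn (y : R) (n : nat) : sin (y + n%:R * (2 * pi)) = sin y.
  by rewrite mulr_natl mulr_natl (periodicn (@sinD2pi R)).
have sinz (y : R) (k : int) : sin (y + k%:~R * (2 * pi)) = sin y.
  case: k => n; first exact: sinn.
  by rewrite NegzE -(sinn _ n.+1) mulrNz mulNr subrK.
rewrite /circle_sin /angle.
set q : Quotient.quot _ := \pi_(_) x.
have : repr q = x %[mod Quotient.quot (@two_pi_multiple R : zmodClosed R)].
  by rewrite reprK.
move/eqP; rewrite -Quotient.idealrBE unfold_in => /intrP[k hk].
rewrite -[repr q](subrK x) addrC -(sinz x k) -hk divfK//.
by rewrite mulf_neq0 ?pnatr_eq0 // gt_eqF // pi_gt0.
Qed.

Definition geodesic (R : realType) (a b : circle R) : R :=
  inf [set `|x| | x in [set x : R | angle x = a - b]].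

Record weighted_graph (R : realType) (V : finType) := WeightedGraph {
  weight :> V -> V -> R ;
  weight_sym : forall u v, weight u v = weight v u ;
  weight_ge0 : forall u v, 0 <= weight u v ;
  degree_gt0 : forall u, 0 < \sum_v weight u v ;
  graph_nonempty : (0 < #|V|)%N ;
  graph_connected : forall u v, connect (fun x y => 0 < weight x y) u v
}.

Definition degree (R : realType) (V : finType) (G : weighted_graph R V)
  (u : V) : R := \sum_v G u v.

(* The self-loop at u is the singleton [set u; u] = [set u]. *)
Definition edges (R : realType) (V : finType) (G : weighted_graph R V) :
    {set {set V}} :=
  [set e : {set V} | [exists u, exists v, (e == [set u; v]) && (0 < G u v)]]%SET.

Definition edge (R : realType) (V : finType) (G : weighted_graph R V) :
    finType :=
  {e : {set V} | e \in edges G}.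

(* The Markov semigroup with jump rate [q x y] from x to y, for x != y; [q] is
   not used on the diagonal.  The derivative of [p t x x] at 0 is minus the sum
   of the rates out of x, by [ts_sum1]. *)
Record transition_semigroup (R : realType) (S : finType) (q : S -> S -> R)
    (p : R -> S -> S -> R) : Prop := {
  ts_ge0 : forall t x y, 0 <= t -> 0 <= p t x y ;
  ts_sum1 : forall (t : R) x, 0 <= t -> \sum_y p t x y = 1 ;
  ts_0 : forall x y, p 0 x y = (x == y)%:R ;
  ts_add : forall s t x y, 0 <= s -> 0 <= t ->
    p (s + t) x y = \sum_z p s x z * p t z y ;
  ts_rate : forall x y, x != y -> h^-1 * p h x y @[h --> 0^'+] --> q x y
}.

Record markov_chain (d : measure_display) (T : measurableType d)
    (R : realType) (P : probability T R) (S : finType) (q : S -> S -> R)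
    (x0 : S) (X : R -> T -> S) : Prop := {
  mc_measurable : forall (t : R) x, 0 <= t -> measurable (X t @^-1` [set x]) ;
  mc_law : exists2 p : R -> S -> S -> R, transition_semigroup q p &
    forall (n : nat) (t : nat -> R) (x : nat -> S),
      t 0%N = 0 -> (forall k, (k < n)%N -> t k <= t k.+1) ->
      P (\bigcap_(k in [set k | (k <= n)%N]) (X (t k) @^-1` [set x k])) =
      ((x0 == x 0%N)%:R *
       \prod_(k < n) p (t k.+1 - t k) (x k) (x k.+1))%:E ;
  mc_right_continuous : {ae P, forall w, forall t : R, 0 <= t ->
    \forall s \near t^'+, X s w = X t w} ;
  mc_left_limits : {ae P, forall w, forall t : R, 0 < t ->
    exists x, \forall s \near t^'-, X s w = x}
}.

Definition process_sigma (T : Type) (R : realType) (S : Type)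
    (X : R -> T -> S) : set (set T) :=
  <<s [set A | exists2 t : R, 0 <= t & exists B : set S, A = X t @^-1` B] >>.

(* Taking A i = setT for some i gives the product rule for subfamilies. *)
Definition independent_processes (d : measure_display) (T : measurableType d)
    (R : realType) (P : probability T R) (I : finType) (S : Type)
    (X : I -> R -> T -> S) : Prop :=
  forall A : I -> set T, (forall i, process_sigma (X i) (A i)) ->
    P (\bigcap_(i in [set: I]) A i) = (\prod_(i : I) P (A i))%E.

(* A jump of the walk from u to itself along a self-loop leaves the path
   unchanged, so only the rates between distinct vertices matter. *)
Definition walk_rate (R : realType) (V : finType) (G : weighted_graph R V)
  (eps : R) (u v : V) : R := eps^-1 * (G u v / degree G u).

Definition krw_walks (d : measure_display) (T : measurableType d)
    (R : realType) (P : probability T R) (V : finType)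
    (G : weighted_graph R V) (N : nat) (eps : R) (x0 : 'I_N -> V)
    (X : 'I_N -> R -> T -> V) : Prop :=
  (forall i, markov_chain P (walk_rate G eps) (x0 i) (X i)) /\
  independent_processes P X.

Definition krw_drift (R : realType) (V : finType) (G : weighted_graph R V)
    (N : nat) (K : R) (omega : 'I_N -> R) (theta : 'I_N -> circle R)
    (x : 'I_N -> V) (i : 'I_N) : R :=
  omega i + K / N%:R * \sum_j G (x i) (x j) * circle_sin (theta j - theta i).

Definition krw_fixed_point (d : measure_display) (T : measurableType d)
    (R : realType) (P : probability T R) (V : finType)
    (G : weighted_graph R V) (N : nat) (K : R) (omega : 'I_N -> R)
    (X : 'I_N -> R -> T -> V) (theta : 'I_N -> circle R) : Prop :=
  {ae P, forall w, forall t : R, 0 <= t -> forall i,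
    krw_drift G K omega theta (fun j => X j t w) i = 0}.

Definition krw_S1 (R : realType) (V : finType) (G : weighted_graph R V)
    (N : nat) (K : R) (omega : 'I_N -> R) : set ('I_N -> circle R) :=
  [set theta | forall x i, krw_drift G K omega theta x i = 0].

(* States: [true] is 1 (open), [false] is 0 (closed). *)
Definition edge_rate (R : realType) (eps kappa : R) (a b : bool) : R :=
  if a == b then 0 else if a then eps^-1 else kappa.

Definition drc_edges (d : measure_display) (T : measurableType d)
    (R : realType) (P : probability T R) (V : finType)
    (G : weighted_graph R V) (eps kappa : R)
    (Y : edge G -> R -> T -> bool) : Prop :=
  (forall e, markov_chain P (edge_rate eps kappa) true (Y e)) /\
  independent_processes P Y.

Definition open_edges (T : Type) (R : realType) (V : finType)
    (G : weighted_graph R V) (Y : edge G -> R -> T -> bool) (t : R) (w : T) :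
    {set {set V}} :=
  [set val e | e : edge G & Y e t w]%SET.

Definition drc_drift (R : realType) (V : finType) (G : weighted_graph R V)
    (K : R) (omega : V -> R) (theta : V -> circle R) (F : {set {set V}})
    (u : V) : R :=
  omega u + K / #|V|%:R *
    \sum_v (if [set u; v]%SET \in F then G u v else 0) *
           circle_sin (theta v - theta u).

Definition drc_fixed_point (d : measure_display) (T : measurableType d)
    (R : realType) (P : probability T R) (V : finType)
    (G : weighted_graph R V) (K : R) (omega : V -> R)
    (Y : edge G -> R -> T -> bool) (theta : V -> circle R) : Prop :=
  {ae P, forall w, forall t : R, 0 <= t -> forall u,
    drc_drift G K omega theta (open_edges Y t w) u = 0}.

Definition drc_S2 (R : realType) (V : finType) (G : weighted_graph R V)
    (K : R) (omega : V -> R) : set (V -> circle R) :=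
  [set theta | forall F : {set {set V}}, F \subset edges G ->
    forall u, drc_drift G K omega theta F u = 0].

(* Main.v *)
Require Import Defs.
From mathcomp Require Import all_boot all_order all_algebra.
From mathcomp Require Import all_classical all_reals all_analysis.
From mathcomp Require Import lra.
Import Order.TTheory GRing.Theory Num.Theory.
Import numFieldNormedType.Exports.

Set Implicit Arguments.
Unset Strict Implicit.
Unset Printing Implicit Defensive.

Local Open Scope classical_set_scope.
Local Open Scope ring_scope.

(* (a) Let p_h be the transition semigroup of an irreducible chain on a finite
   state space S.  For small h > 0, all entries of p_h on the diagonal and along
   positive rates are positive, so with tau = #|S| h every entry of p_tau is
   positive.  For finitely many independent chains observed at times k tau, each
   step therefore reaches a prescribed joint state with probability at least
   some delta > 0, and that state is avoided for m steps with probability at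
   most (1 - delta)^m.  Hence almost surely every joint state is visited, and an
   equilibrium along the path is an equilibrium for every configuration.
   (b) A geodesic distance is 0 or pi iff the sine of the difference vanishes.
   For KRW, comparing two configurations that differ in one walker isolates one
   sine; for DRC, opening a single edge does, and connectivity extends this to
   all pairs since sin (a + b) = 0 when sin a = sin b = 0. *)

(** * Lifts of angles and geodesic distance on the circle *)

Lemma angle_surj (R : realType) (a : circle R) : exists x : R, angle x = a.
Proof.
exists (repr (a : Quotient.quot (@two_pi_multiple R : zmodClosed R))).
exact: reprK.
Qed.

Lemma angleD (R : realType) (x y : R) : angle (x + y) = angle x + angle y.
Proof.
exact: (raddfD
  (\pi_(Quotient.quot (@two_pi_multiple R : zmodClosed R)))%qT).
Qed.

Lemma angle_eqP (R : realType) (x y : R) :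
  angle x = angle y <-> exists k : int, x = y + k%:~R * (2 * pi).
Proof.
have pi2 : 2 * pi != 0 :> R by rewrite mulf_neq0 ?pnatr_eq0 // gt_eqF // pi_gt0.
split=> [/eqP|[k ->]].
  rewrite -Quotient.idealrBE unfold_in => /intrP[k hk]; exists k.
  by rewrite -hk divfK// addrC subrK.
apply/eqP; rewrite -Quotient.idealrBE unfold_in addrAC subrr add0r mulfK//.
Qed.

(** The infimum is attained at the lift in [-pi, pi): every other lift differs from it by at least 2
    pi, so its absolute value is at least pi. *)
Lemma exists_geodesic_rep (R : realType) (a b : circle R) :
  exists x : R, [/\ angle x = a - b, `|x| <= pi & geodesic a b = `|x|].
Proof.
have pi0 := pi_gt0 R.
have [y hy] := angle_surj (a - b).
(* The shift by pi before taking the floor centres the period: y - 2 pi k lies in [-pi, pi). *)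
pose k := Num.floor ((y + pi) / (2 * pi)).
pose x := y + (- k)%:~R * (2 * pi).
have ax : angle x = a - b.
  by rewrite -hy; apply/angle_eqP; exists (- k).
have xpi : `|x| <= pi.
  have := mem_rg1_floor ((y + pi) / (2 * pi)); rewrite -/k => /andP[].
  rewrite ler_pdivlMr ?mulr_gt0// ltr_pdivrMr ?mulr_gt0//.
  rewrite /x mulrDl mul1r ler_norml mulrNz mulNr => h1 h2.
  by apply/andP; split; lra.
exists x; split=> //.
have lbx : lbound [set `|z| | z in [set z : R | angle z = a - b]] `|x|.
  move=> _ [z /= az <-].
  have /angle_eqP[m ->] : angle z = angle x by rewrite az ax.
  have [->|m0] := eqVneq m 0; first by rewrite mul0r addr0.
  have h1 : (1 : R) <= `|m%:~R|.
    by rewrite -intr_norm (ler_int _ 1) -gtz0_ge1 normr_gt0.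
  have h2 : 2 * pi <= `|m%:~R * (2 * pi)| :> R.
    rewrite normrM (gtr0_norm (x := 2 * pi)) ?mulr_gt0//.
    by rewrite ler_peMl// mulr_ge0// ltW.
  (* Reverse triangle inequality: |x + 2 pi m| >= 2 pi - |x| >= pi >= |x|. *)
  have := lerB_normD (m%:~R * (2 * pi)) x; rewrite addrC [x + _]addrC; lra.
apply/eqP; rewrite eq_le; apply/andP; split.
  by apply: ge_inf; [exists `|x| | exists x].
by apply: lb_le_inf lbx; exists `|x|; exists x.
Qed.

(** For the shortest lift x, |x| lies in [0, pi], and the sine is positive strictly inside this
    interval. *)
Lemma geodesic_0_or_pi (R : realType) (a b : circle R) :
  geodesic a b = 0 \/ geodesic a b = pi <-> circle_sin (a - b) = 0.
Proof.
have [x [<- xpi ->]] := exists_geodesic_rep a b.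
rewrite circle_sin_angle; split.
  case=> [/normr0_eq0 ->|]; first exact: sin0.
  case: (ger0P x) => _ e; first by rewrite e sinpi.
  by rewrite -[x]opprK e sinN sinpi oppr0.
move=> s0.
have sn0 : sin `|x| = 0.
  by case: (ger0P x) => _ //; rewrite sinN s0 oppr0.
have [|x0] := eqVneq `|x| 0; first by left.
right; apply/eqP; rewrite eq_le xpi leNgt; apply/negP => xlt.
have : 0 < sin `|x|.
  by apply: sin_gt0_pi; rewrite xlt lt_neqAle eq_sym x0 normr_ge0.
by rewrite sn0 ltxx.
Qed.

Lemma circle_sin0 (R : realType) : circle_sin (0 : circle R) = 0.
Proof.
have -> : (0 : circle R) = angle 0.
  by apply: (addrI (angle 0)); rewrite -angleD !addr0.
by rewrite circle_sin_angle sin0.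
Qed.

Lemma circle_sin_eq0D (R : realType) (a b : circle R) :
  circle_sin a = 0 -> circle_sin b = 0 -> circle_sin (a + b) = 0.
Proof.
have [[x <-] [y <-]] := (angle_surj a, angle_surj b).
rewrite -angleD !circle_sin_angle sinD => -> ->.
by rewrite mul0r mulr0 addr0.
Qed.

(** * The deterministic sets for zero natural frequencies *)

Lemma krw_S1_omega0 (R : realType) (V : finType) (G : weighted_graph R V)
    (K : R) (N : nat) : 0 < K -> (forall u, 0 < G u u) ->
  (exists u v : V, u != v /\ G u v = 0) ->
  krw_S1 G K (fun _ : 'I_N => 0) =
  [set theta : 'I_N -> circle R | forall i j,
    geodesic (theta i) (theta j) = 0 \/ geodesic (theta i) (theta j) = pi].
Proof.
move=> K0 loop [u [v [uv Guv]]]; apply/seteqP; split=> theta /= h.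
  move=> j i; apply/geodesic_0_or_pi.
  have [->|ij] := eqVneq i j; first by rewrite subrr circle_sin0.
  have KN : K / N%:R != 0.
    by rewrite mulf_neq0 ?gt_eqF// invr_gt0 ltr0n (leq_trans _ (ltn_ord i)).
  have sum0 x : \sum_k G (x i) (x k) * circle_sin (theta k - theta i) = 0.
    have /eqP := h x i.
    by rewrite /krw_drift add0r mulf_eq0 (negbTE KN) => /eqP.
  (* Moving walker j from u to the non-neighbour v kills its term only. *)
  have := sum0 (fun k => if k == j then v else u).
  have := sum0 (fun=> u).
  rewrite !(bigD1 j (P := xpredT))//= eqxx (negbTE ij) Guv mul0r add0r => h1 h2.
  move/eqP: h1; rewrite [X in _ + X](_ : _ = 0) ?addr0.
    (* The self-loop enters here: the surviving term has weight [G u u > 0]. *)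
    by rewrite mulf_eq0 gt_eqF//= => /eqP.
  by rewrite -[RHS]h2; apply: eq_bigr => k /negbTE ->.
move=> x i; rewrite /krw_drift add0r big1 ?mulr0// => k _.
by have /geodesic_0_or_pi -> := h k i; rewrite mulr0.
Qed.

Lemma drc_S2_omega0 (R : realType) (V : finType) (G : weighted_graph R V)
    (K : R) : 0 < K ->
  drc_S2 G K (fun _ : V => 0) =
  [set theta : V -> circle R | forall u v,
    geodesic (theta u) (theta v) = 0 \/ geodesic (theta u) (theta v) = pi].
Proof.
move=> K0; apply/seteqP; split=> theta /= h; last first.
  move=> F _ u; rewrite /drc_drift add0r big1 ?mulr0// => v _.
  by have /geodesic_0_or_pi -> := h v u; rewrite mulr0.
have adj u v : 0 < G u v -> circle_sin (theta v - theta u) = 0.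
  move=> Guv.
  have sub : [set [set u; v]]%SET \subset edges G.
    rewrite finset.sub1set inE.
    apply/existsP; exists u; apply/existsP; exists v.
    by rewrite eqxx.
  have KN : K / #|V|%:R != 0.
    by rewrite mulf_neq0 ?gt_eqF// invr_gt0 ltr0n (graph_nonempty G).
  have /eqP := h _ sub u; rewrite /drc_drift add0r mulf_eq0 (negbTE KN) /=.
  rewrite (bigD1 v)//= set11 big1 ?addr0 => [|w wv].
    by rewrite mulf_eq0 gt_eqF//= => /eqP.
  (* Another term survives only if {u, w} = {u, v}; as w is not v, this forces w = u, where the sine
     is sin 0. *)
  case: ifP; rewrite ?mul0r// inE => /eqP e.
  have : w \in [set u; v]%SET by rewrite -e !inE eqxx orbT.
  rewrite !inE (negbTE wv) orbF => /eqP ->.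
  by rewrite subrr circle_sin0 mulr0.
move=> u v; apply/geodesic_0_or_pi.
have /connectP[p pth ->] := graph_connected G v u.
elim: p v pth => [|w p IH] v /=; first by rewrite subrr circle_sin0.
(* The phase difference telescopes through the first vertex w of the path. *)
move=> /andP[vw /IH pw]; rewrite -(subrK (theta w) (theta (last w p))) -addrA.
by apply: circle_sin_eq0D => //; exact: adj.
Qed.

(** * Positivity of transition probabilities *)

(** Off the diagonal, a positive derivative at 0 makes p_h positive. On the diagonal, the row sums
    to 1 and the mass leaving x is O(h). *)
Lemma semigroup_local_pos (R : realType) (S : finType) (q : S -> S -> R)
    (p : R -> S -> S -> R) : transition_semigroup q p ->
  \forall h \near 0^'+, forall x y, (x == y) || (0 < q x y) -> 0 < p h x y.
Proof.
move=> hp; apply: filter_forall => x; apply: filter_forall => y.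
have [<- {y}|xy] := eqVneq x y; last first.
  have [qxy|_] := ltP 0 (q x y); last by near=> h.
  near=> h => _; have h0 : 0 < h by near: h; exact: nbhs_right_gt.
  rewrite -(pmulr_rgt0 _ (_ : 0 < h^-1)) ?invr_gt0//.
  by near: h; exact: cvgr_gt (ts_rate hp xy) _ qxy.
(* The mass leaving x is at most h Q, hence below 1 once h <= 1 / (Q + 1). The extra 1 keeps the
   denominator positive when S has one point and Q = 0. *)
pose Q := \sum_(y | y != x) (`|q x y| + 1).
have Q0 : 0 < Q + 1 by rewrite ltr_wpDl// sumr_ge0// => y _; rewrite addr_ge0.
have rate_lt : \forall h \near 0^'+,
    forall y, y != x -> h^-1 * p h x y < `|q x y| + 1.
  apply: filter_forall => y; have [->|yx] := eqVneq y x; first by near=> h.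
  rewrite eq_sym in yx; have qlt : q x y < `|q x y| + 1.
    by rewrite (le_lt_trans (ler_norm _))// ltrDl.
  by apply: filterS (cvgr_lt _ (ts_rate hp yx) _ qlt) => h + _.
near=> h => _; have h0 : 0 < h by near: h; exact: nbhs_right_gt.
have : \sum_y p h x y = 1 by apply: (ts_sum1 hp); exact: ltW.
rewrite (bigD1 x)//= => sum1.
rewrite -[ltRHS](addrK (\sum_(y | y != x) p h x y)) sum1 subr_gt0.
have leQ : \sum_(y | y != x) p h x y <= h * Q.
  rewrite mulr_sumr; apply: ler_sum => y yx.
  rewrite -ler_pdivrMl// ltW//.
  by move: y yx; near: h.
apply: (le_lt_trans leQ); apply: (@lt_le_trans _ _ (h * (Q + 1))).
  by rewrite ltr_pM2l// ltrDl.
rewrite -ler_pdivlMr// mul1r; near: h; apply: nbhs_right_le.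
by rewrite invr_gt0.
Unshelve. all: by end_near. Qed.

(** Each step of a path costs time h. A simple path needs at most #|S| steps, and the time left over
    is spent staying put, so one time serves all pairs. *)
Lemma semigroup_pos (R : realType) (S : finType) (q : S -> S -> R)
    (p : R -> S -> S -> R) : transition_semigroup q p ->
  (forall x y, connect (fun x y => 0 < q x y) x y) ->
  \forall h \near 0^'+, forall x y, 0 < p (#|S|%:R * h) x y.
Proof.
move=> hp irr; near=> h => x y.
have h0 : 0 < h by near: h; exact: nbhs_right_gt.
have loc : forall x' y', (x' == y') || (0 < q x' y') -> 0 < p h x' y'.
  by near: h; exact: semigroup_local_pos hp.
have step n u v z : 0 < p h u v -> 0 < p (n%:R * h) v z ->
    0 < p (n.+1%:R * h) u z.
  move=> p1 p2; have nh : 0 <= n%:R * h by rewrite mulr_ge0// ltW.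
  rewrite -natr1 addrC mulrDl mul1r (ts_add hp) ?(ltW h0)// (bigD1 v)//=.
  rewrite ltr_pwDl ?mulr_gt0// sumr_ge0// => w _.
  by rewrite mulr_ge0 ?(ts_ge0 hp)// ltW.
have walk n s u : path (fun a b => 0 < q a b) u s -> (size s <= n)%N ->
    0 < p (n%:R * h) u (last u s).
  elim: n s u => [|n IH] [|v s] u //=.
  - by rewrite mul0r (ts_0 hp) eqxx.
  - by move=> _ _; apply: (step n u u); [rewrite loc ?eqxx|exact: (IH [::])].
  - by move=> /andP[uv vs] sn; apply: (step n u v);
      [rewrite loc ?uv ?orbT|exact: IH].
have /connectP[s0 + ->] := irr x y.
case/shortenP => s xs us _; apply: walk xs _.
have /card_uniqP : uniq s by case/andP: us.
by move=> <-; exact: max_card.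
Unshelve. all: by end_near. Qed.

(** * Independent chains observed on a time grid *)

Lemma measure_le_sum (d : measure_display) (T : measurableType d)
    (R : realType) (P : probability T R) (J : finType) (Q : {pred J})
    (A : set T) (B : J -> set T) :
  measurable A -> (forall j, Q j -> measurable (B j)) ->
  (forall w, A w -> exists2 j, Q j & B j w) ->
  (P A <= \sum_(j | Q j) P (B j))%E.
Proof.
move=> mA mB AB; rewrite bigfs ?index_enum_uniq//; last first.
  by move=> j _; rewrite mem_index_enum.
apply: content_sub_fsum => // w /AB[j Qj Bj]; exists j.
Qed.

Lemma prod_transition_sum1 (R : realType) (S I : finType)
    (q : S -> S -> R) (p : I -> R -> S -> S -> R) (t : R) (y : I -> S) :
  (forall i, transition_semigroup q (p i)) -> 0 <= t ->
  \sum_(z : {ffun I -> S}) \prod_i p i t (y i) (z i) = 1.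
Proof.
move=> hp t0; rewrite -(bigA_distr_bigA (fun i s => p i t (y i) s)).
by rewrite big1// => i _; exact: (ts_sum1 (hp i)).
Qed.

Definition cylinder (T : Type) (R : realType) (S I : finType)
    (X : I -> R -> T -> S) (tau : R) (n : nat) (y : nat -> {ffun I -> S}) :
    set T :=
  \bigcap_(i in [set: I]) \bigcap_(k in [set k | (k <= n)%N])
    (X i (k%:R * tau) @^-1` [set y k i]).

(** The window opens at step n + 1, just after the last step fixed by a cylinder of length n. *)
Definition avoid (T : Type) (R : realType) (S I : finType)
    (X : I -> R -> T -> S) (tau : R) (x : {ffun I -> S}) (n m : nat) : set T :=
  \bigcap_(k in [set k | (n < k <= n + m)%N])
    ~` \bigcap_(i in [set: I]) (X i (k%:R * tau) @^-1` [set x i]).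

Definition cylinder_prob (R : realType) (S I : finType)
    (p : I -> R -> S -> S -> R) (x0 : I -> S) (tau : R) (n : nat)
    (y : nat -> {ffun I -> S}) : R :=
  \prod_i ((x0 i == y 0%N i)%:R * \prod_(k < n) p i tau (y k i) (y k.+1 i)).

Lemma measurable_cylinder (d : measure_display) (T : measurableType d)
    (R : realType) (P : probability T R) (S I : finType) (q : S -> S -> R)
    (x0 : I -> S) (X : I -> R -> T -> S) (tau : R) (n : nat)
    (y : nat -> {ffun I -> S}) :
  (forall i, markov_chain P q (x0 i) (X i)) -> 0 <= tau ->
  measurable (cylinder X tau n y).
Proof.
move=> hX tau0; apply: fin_bigcap_measurable => // i _.
apply: bigcap_measurable; first by exists 0%N.
by move=> k _; apply: (mc_measurable (hX i)); rewrite mulr_ge0.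
Qed.

Lemma measurable_avoid (d : measure_display) (T : measurableType d)
    (R : realType) (P : probability T R) (S I : finType) (q : S -> S -> R)
    (x0 : I -> S) (X : I -> R -> T -> S) (tau : R) (x : {ffun I -> S})
    (n m : nat) :
  (forall i, markov_chain P q (x0 i) (X i)) -> 0 <= tau ->
  measurable (avoid X tau x n m).
Proof.
move=> hX tau0; apply: bigcap_measurableType => k _.
apply: measurableC; apply: fin_bigcap_measurable => // i _.
by apply: (mc_measurable (hX i)); rewrite mulr_ge0.
Qed.

Lemma cylinder_probE (d : measure_display) (T : measurableType d)
    (R : realType) (P : probability T R) (S I : finType)
    (x0 : I -> S) (X : I -> R -> T -> S) (p : I -> R -> S -> S -> R) (tau : R)
    (n : nat) (y : nat -> {ffun I -> S}) :
  independent_processes P X -> 0 <= tau ->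
  (forall i (n : nat) (t : nat -> R) (x : nat -> S),
      t 0%N = 0 -> (forall k, (k < n)%N -> t k <= t k.+1) ->
      P (\bigcap_(k in [set k | (k <= n)%N]) (X i (t k) @^-1` [set x k])) =
      ((x0 i == x 0%N)%:R *
       \prod_(k < n) p i (t k.+1 - t k) (x k) (x k.+1))%:E) ->
  P (cylinder X tau n y) = (cylinder_prob p x0 tau n y)%:E.
Proof.
move=> ind tau0 law; rewrite [LHS]ind; last first.
  move=> i; apply: (@bigcap_measurableType _ (g_sigma_algebraType _)) => k _.
   apply: sub_gen_smallest; exists (k%:R * tau); first by rewrite mulr_ge0.
  by exists [set y k i].
rewrite -prodEFin; apply: eq_bigr => i _.
rewrite (law i n (fun k => k%:R * tau) (fun k => y k i)) ?mul0r//.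
  congr (_ * _)%:E; apply: eq_bigr => k _; congr (p i _ _ _).
  by rewrite -mulrBl -natr1 addrAC subrr add0r mul1r.
by move=> k _; rewrite ler_wpM2r// ler_nat.
Qed.

Lemma cylinder_prob_ge0 (R : realType) (S I : finType) (q : S -> S -> R)
    (p : I -> R -> S -> S -> R) (x0 : I -> S) (tau : R) (n : nat)
    (y : nat -> {ffun I -> S}) :
  (forall i, transition_semigroup q (p i)) -> 0 <= tau ->
  0 <= cylinder_prob p x0 tau n y.
Proof.
move=> hp tau0; apply: prodr_ge0 => i _; rewrite mulr_ge0//.
by apply: prodr_ge0 => k _; exact: (ts_ge0 (hp i)).
Qed.

(** This is the Markov property in the form used below: the factor for one more step depends on the
    past only through [y n]. *)
Lemma cylinder_probS (R : realType) (S I : finType)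
    (p : I -> R -> S -> S -> R) (x0 : I -> S) (tau : R) (n : nat)
    (y : nat -> {ffun I -> S}) (z : {ffun I -> S}) :
  cylinder_prob p x0 tau n.+1 (fun k => if (k <= n)%N then y k else z) =
  cylinder_prob p x0 tau n y * \prod_i p i tau (y n i) (z i).
Proof.
rewrite /cylinder_prob -big_split /=; apply: eq_bigr => i _.
rewrite big_ord_recr /= leqnn ltnn -mulrA; congr (_ * (_ * _)).
by apply: eq_bigr => k _; rewrite ltn_ord (ltnW (ltn_ord k)).
Qed.

(** Instead of conditioning, the induction on m splits over the next joint state z, which differs
    from x; the transitions to such z have total probability at most 1 - delta. *)
Lemma avoid_bound (d : measure_display) (T : measurableType d)
    (R : realType) (P : probability T R) (S I : finType) (q : S -> S -> R)
    (x0 : I -> S) (X : I -> R -> T -> S) (p : I -> R -> S -> S -> R)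
    (tau delta : R) (x : {ffun I -> S}) :
  (forall i, markov_chain P q (x0 i) (X i)) ->
  (forall i, transition_semigroup q (p i)) ->
  (forall n y, P (cylinder X tau n y) =
     (cylinder_prob p x0 tau n y)%:E) ->
  0 <= tau -> delta <= 1 ->
  (forall y : {ffun I -> S}, delta <= \prod_i p i tau (y i) (x i)) ->
  forall m n y,
  (P (cylinder X tau n y `&` avoid X tau x n m) <=
    ((1 - delta) ^+ m * cylinder_prob p x0 tau n y)%:E)%E.
Proof.
move=> hX hp hC tau0 delta1 hdelta.
have mC n y : measurable (cylinder X tau n y).
  by exact: measurable_cylinder hX _.
have mA n m : measurable (avoid X tau x n m).
  by exact: measurable_avoid hX _.
elim=> [|m IH] n y.
  by rewrite expr0 mul1r -hC le_measure ?inE//; exact: measurableI.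
pose ext z := fun k => if (k <= n)%N then y k else z.
apply: (@le_trans _ _ (\sum_(z : {ffun I -> S} | z != x)
    P (cylinder X tau n.+1 (ext z) `&`
       avoid X tau x n.+1 m))%E).
  apply: measure_le_sum => [|z _|]; [exact: measurableI|exact: measurableI|].
  (* The witness z is the state actually occupied at step n + 1. *)
  move=> w [Cw Aw]; exists [ffun i => X i (n.+1%:R * tau) w].
    apply/eqP => zx; apply: (Aw n.+1) => [|i _ /=].
      by rewrite /= ltnSn addnS ltnS leq_addr.
    by rewrite -zx ffunE.
  split=> [i _ k /= kn|k /= /andP[nk km]].
    rewrite /ext; case: leqP => [kn'|nk]; first exact: Cw.
    by rewrite ffunE; have -> : k = n.+1 by apply/eqP; rewrite eqn_leq kn nk.
  by apply: Aw; rewrite /= (ltnW nk) addnS -addSn.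
apply: (@le_trans _ _ (\sum_(z : {ffun I -> S} | z != x)
    ((1 - delta) ^+ m * cylinder_prob p x0 tau n.+1 (ext z))%:E)%E).
  by apply: lee_sum => z _; exact: IH.
rewrite sumEFin lee_fin -mulr_sumr exprSr -mulrA.
rewrite ler_wpM2l ?exprn_ge0 ?subr_ge0//.
under eq_bigr do rewrite cylinder_probS.
rewrite -mulr_sumr mulrC ler_wpM2r ?(cylinder_prob_ge0 _ _ _ hp)//.
have := prod_transition_sum1 (y n) hp tau0.
rewrite (bigD1 x)//= => sum1.
by rewrite lerBrDr -[leRHS]sum1 [leRHS]addrC lerD2l.
Qed.

Lemma markov_chains_visit (d : measure_display) (T : measurableType d)
    (R : realType) (P : probability T R) (S I : finType) (q : S -> S -> R)
    (x0 : I -> S) (X : I -> R -> T -> S) :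
  (forall x y, connect (fun x y => 0 < q x y) x y) ->
  (forall i, markov_chain P q (x0 i) (X i)) -> independent_processes P X ->
  {ae P, forall w, forall x : I -> S,
    exists2 t : R, 0 <= t & forall i, X i t w = x i}.
Proof.
move=> irr hX ind.
have /choice[p hp] i : exists p : R -> S -> S -> R, transition_semigroup q p /\
    forall (n : nat) (t : nat -> R) (x : nat -> S),
      t 0%N = 0 -> (forall k, (k < n)%N -> t k <= t k.+1) ->
      P (\bigcap_(k in [set k | (k <= n)%N]) (X i (t k) @^-1` [set x k])) =
      ((x0 i == x 0%N)%:R *
       \prod_(k < n) p (t k.+1 - t k) (x k) (x k.+1))%:E.
  by have [p hp law] := mc_law (hX i); exists p.
have sg i := (hp i).1.
(* Finiteness of [I] gives one h for all chains; tau = #|S| h is 0 only if [S] is empty. *)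
have [tau tau0 taupos] : exists2 tau : R, 0 <= tau &
    forall i x y, 0 < p i tau x y.
  have : \forall h \near (0 : R)^'+, 0 < h /\
      forall i x y, 0 < p i (#|S|%:R * h) x y.
    near=> h; split; first by near: h; exact: nbhs_right_gt.
    near: h; apply: filter_forall => i; exact: semigroup_pos (sg i) irr.
  case/filter_ex => h [h0 hh]; exists (#|S|%:R * h) => //.
  by rewrite mulr_ge0// ltW.
have hC n y := cylinder_probE n y ind tau0
  (fun i => (hp i).2).
(* As finite functions, the joint states form a finite type, so almost sure visits to each one give
   almost sure visits to all. *)
suff visit (x : {ffun I -> S}) : {ae P, forall w,
    exists2 t : R, 0 <= t & forall i, X i t w = x i}.
  have : {ae P, forall w, forall x : {ffun I -> S},
      exists2 t : R, 0 <= t & forall i, X i t w = x i}.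
    by apply: filter_forall.
  apply: filterS => w hw x; have [t t0 ht] := hw [ffun i => x i].
  by exists t => // i; rewrite ht ffunE.
(* Finitely many positive products have a common positive lower bound; the cap at 1 keeps 1 - delta
   nonnegative. *)
have [delta [delta0 delta1 hdelta]] : exists delta : R, [/\ 0 < delta,
    delta <= 1 &
    forall y : {ffun I -> S}, delta <= \prod_i p i tau (y i) (x i)].
  have : \forall e \near (0 : R)^'+, [/\ 0 < e, e <= 1 &
      forall y : {ffun I -> S}, e <= \prod_i p i tau (y i) (x i)].
    near=> e; split; [by near: e; exact: nbhs_right_gt
                     |by near: e; exact: nbhs_right_le|].
    near: e; apply: filter_forall => y; apply: nbhs_right_le.
    by apply: prodr_gt0.
  exact: filter_ex.
pose N := \bigcap_m avoid X tau x 0 m.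
have mA m : measurable (avoid X tau x 0 m) by exact: measurable_avoid hX _.
have mN : measurable N by exact: bigcap_measurableType.
exists N; split=> //; last first.
  move=> w; apply: contra_notP => /existsNP[m /not_implyP[_ /existsNP[k]]].
  move=> /not_implyP[_ /contrapT hit]; exists (k%:R * tau).
    by rewrite mulr_ge0.
  by move=> i; exact: hit.
(* Splitting over the state at time 0 leaves a constant M independent of m, so the geometric factor
   sends the bound to 0. *)
pose M := \sum_(z : {ffun I -> S}) cylinder_prob p x0 tau 0 (fun=> z).
have PN m : (P N <= ((1 - delta) ^+ m * M)%:E)%E.
  apply: (@le_trans _ _ (\sum_(z : {ffun I -> S})
      P (cylinder X tau 0 (fun=> z) `&` avoid X tau x 0 m))%E).
    apply: measure_le_sum => // [z _|w Nw].
      by apply: measurableI => //; exact: measurable_cylinder hX _.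
    exists [ffun i => X i 0 w] => //; split; last exact: Nw.
    by move=> i _ k /=; rewrite leqn0 => /eqP ->; rewrite mul0r ffunE.
  rewrite /M mulr_sumr -sumEFin; apply: lee_sum => z _.
  exact: avoid_bound hX sg hC tau0 delta1 hdelta m 0%N (fun=> z).
have PNfin : P N \is a fin_num by exact: fin_num_measure.
apply/eqP; rewrite eq_le measure_ge0 andbT -(fineK PNfin) lee_fin.
have cv : (1 - delta) ^+ m * M @[m --> \oo] --> 0 * M.
  apply: cvgMr_tmp; apply: cvg_expr.
  by rewrite ger0_norm ?subr_ge0// ltrBlDr ltrDl.
rewrite mul0r in cv.
rewrite leNgt; apply/negP => /(cvgr_lt _ cv)/filter_ex[m].
by apply/negP; rewrite -leNgt -lee_fin (fineK PNfin).
Unshelve. all: by end_near. Qed.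

(** * Transfer from almost every path to the deterministic sets *)

Lemma ae_ex (d : measure_display) (T : measurableType d) (R : realType)
    (P : probability T R) (A : T -> Prop) : {ae P, forall w, A w} ->
  exists w, A w.
Proof.
have P0 : (0 < P setT)%E by rewrite probability_setT lte01.
have := ae_properfilter_algebraOfSetsType P0.
move=> ? hA; exact: filter_ex hA.
Qed.

Lemma walk_rate_connected (R : realType) (V : finType)
    (G : weighted_graph R V) (eps : R) (u v : V) : 0 < eps ->
  connect (fun x y => 0 < walk_rate G eps x y) u v.
Proof.
move=> eps0; have := graph_connected G u v; rewrite (@eq_connect _ _
  (fun x y => 0 < walk_rate G eps x y))// => x y.
by rewrite /walk_rate pmulr_rgt0 ?invr_gt0// pmulr_lgt0// invr_gt0 degree_gt0.
Qed.

Lemma edge_rate_connected (R : realType) (eps kappa : R) (a b : bool) :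
  0 < eps -> 0 < kappa ->
  connect (fun x y => 0 < edge_rate eps kappa x y) a b.
Proof.
move=> eps0 kappa0; have [->|ab] := eqVneq a b; first exact: connect0.
apply: connect1; rewrite /edge_rate (negbTE ab).
by case: (a); rewrite ?invr_gt0.
Qed.

Unset Implicit Arguments.

Theorem proposition1p7 (R : realType) (V : finType) (G : weighted_graph R V)
    (K : R) (hK : 0 < K) :
  (forall (N : nat) (hN : (2 <= N)%N) (hloop : forall u : V, 0 < G u u),
    (forall (d : measure_display) (T : measurableType d) (P : probability T R)
        (omega : 'I_N -> R) (eps : R) (x0 : 'I_N -> V)
        (X : 'I_N -> R -> T -> V),
      0 < eps -> krw_walks P G eps x0 X ->
      (forall theta : 'I_N -> circle R,
        krw_fixed_point P G K omega X theta -> krw_S1 G K omega theta) /\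
      {ae P, forall w, forall theta : 'I_N -> circle R,
        (forall t : R, 0 <= t -> forall i,
          krw_drift G K omega theta (fun j => X j t w) i = 0) ->
        krw_S1 G K omega theta}) /\
    ((exists u v : V, u != v /\ G u v = 0) ->
      krw_S1 G K (fun _ : 'I_N => 0) =
      [set theta : 'I_N -> circle R | forall i j,
        geodesic (theta i) (theta j) = 0 \/
        geodesic (theta i) (theta j) = pi])) /\
  ((forall (d : measure_display) (T : measurableType d) (P : probability T R)
       (omega : V -> R) (eps kappa : R) (Y : edge G -> R -> T -> bool),
     0 < eps -> 0 < kappa -> drc_edges P eps kappa Y ->
     (forall theta : V -> circle R,
       drc_fixed_point P K omega Y theta -> drc_S2 G K omega theta) /\
     {ae P, forall w, forall theta : V -> circle R,
       (forall t : R, 0 <= t -> forall u,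
         drc_drift G K omega theta (open_edges Y t w) u = 0) ->
       drc_S2 G K omega theta}) /\
   drc_S2 G K (fun _ : V => 0) =
   [set theta : V -> circle R | forall u v,
     geodesic (theta u) (theta v) = 0 \/
     geodesic (theta u) (theta v) = pi]).
Proof.
split=> [N N2 loop|]; split.
- move=> d T P omega eps x0 X eps0 [hX ind].
  have visit : {ae P, forall w, forall theta : 'I_N -> circle R,
      (forall t : R, 0 <= t -> forall i,
        krw_drift G K omega theta (fun j => X j t w) i = 0) ->
      krw_S1 G K omega theta}.
    have irr u v := walk_rate_connected G u v eps0.
    have := markov_chains_visit irr hX ind.
    apply: filterS => w hw theta eqw x i; have [t t0 ht] := hw x.
    have -> : x = fun j => X j t w by apply/funext => j; rewrite ht.
    exact: eqw.
  (* Membership in [krw_S1] does not depend on the path, so a single path in both almost sure events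
     suffices. *)
  split=> // theta fixed.
  by have [w [hw eqw]] := ae_ex (filterI visit fixed); exact: hw.
- exact: krw_S1_omega0.
- move=> d T P omega eps kappa Y eps0 kappa0 [hY ind].
  have visit : {ae P, forall w, forall theta : V -> circle R,
      (forall t : R, 0 <= t -> forall u,
        drc_drift G K omega theta (open_edges Y t w) u = 0) ->
      drc_S2 G K omega theta}.
    have irr a b := edge_rate_connected a b eps0 kappa0.
    have := markov_chains_visit irr hY ind.
    apply: filterS => w hw theta eqw F subF u.
    (* The joint state to be visited is the indicator of F on the edges; [subF] ensures that it
       recovers all of F. *)
    have [t t0 ht] := hw (fun e => val e \in F).
    have -> : F = open_edges Y t w; last exact: eqw.
    apply/setP => e; apply/idP/imsetP => [eF|[e' + ->]].
      by exists (Sub e (fintype.subsetP subF e eF)); rewrite ?SubK// inE ht SubK.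
    by rewrite inE ht.
  split=> // theta fixed.
  by have [w [hw eqw]] := ae_ex (filterI visit fixed); exact: hw.
- exact: drc_S2_omega0.
Qed.
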